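(* Let $\Sigma=(A,B,C,D;\mathcal X,\mathcal U,\mathcal Y)$ be a linear discrete time-invariant system. A (possibly unbounded) selfadjoint operator $H$ acting in $\mathcal X$ belongs to $\mathrm{RI}_\Sigma$ if and only if $H$ belongs to $\mathrm{KYP}_\Sigma$, that is, $\mathrm{RI}_\Sigma=\mathrm{KYP}_\Sigma$.
   Context: A system $\Sigma=(A,B,C,D;\mathcal X,\mathcal U,\mathcal Y)$ is the discrete time-invariant linear system $x_{n+1}=Ax_n+Bu_n$, $y_n=Cx_n+Du_n$ $(n\ge 0)$, where $A:\mathcal X\to\mathcal X$, $B:\mathcal U\to\mathcal X$, $C:\mathcal X\to\mathcal Y$, $D:\mathcal U\to\mathcal Y$ are bounded linear operators between separable (complex) Hilbert spaces. For a bounded selfadjoint operator $T$ on a Hilbert space $\mathcal H$, put $\mathcal H_1=\overline{T\mathcal H}$, $\mathcal H_2=\operatorname{Ker}T=\mathcal H\ominus\mathcal H_1$, $T_1=T|_{\mathcal H_1}$ (injective on $\mathcal H_1$). The Moore--Penrose pseudo-inverse $T^{[-1]}$ is the (possibly unbounded) selfadjoint operator with domain $\operatorname{Im}T_1\oplus\mathcal H_2$ acting as $T_1^{-1}$ on $\operatorname{Im}T_1$ and as $0$ on $\mathcal H_2$. $\mathcal D(\cdot)$ denotes the domain of an operator. For a (possibly unbounded) selfadjoint operator $H$ in $\mathcal X$ consider the conditions: (1) $\langle Hx,x\rangle>0$ for each $0\ne x\in\mathcal D(H)$; (2) $A\mathcal D(H^{1/2})\subset\mathcal D(H^{1/2})$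 and $B\mathcal U\subset\mathcal D(H^{1/2})$ (so $H^{1/2}B:\mathcal U\to\mathcal X$ is bounded); (3) the operator $\delta_\Sigma(H)=I_{\mathcal U}-D^*D-(H^{1/2}B)^*H^{1/2}B$ is bounded and nonnegative, and $\big(D^*C+(H^{1/2}B)^*H^{1/2}A\big)\mathcal D(H^{1/2})\subset\delta_\Sigma(H)^{1/2}\mathcal U$; (4) for each $x\in\mathcal D(H^{1/2})$, $$\|H^{1/2}x\|^2-\|H^{1/2}Ax\|^2-\|Cx\|^2\ \ge\ \big\|\big(\delta_\Sigma(H)^{1/2}\big)^{[-1]}\big(D^*C+(H^{1/2}B)^*H^{1/2}A\big)x\big\|^2 ;$$ (5) for all $x\in\mathcal D(H^{1/2})$ and $u\in\mathcal U$, $$\|H^{1/2}x\|^2+\|u\|^2-\|H^{1/2}(Ax+Bu)\|^2-\|Cx+Du\|^2\ \ge\ 0 .$$ $\mathrm{RI}_\Sigma$ (generalized solutions of the Riccati inequality) is the set of all selfadjoint $H$ in $\mathcal X$ satisfying (1), (2), (3), (4). $\mathrm{KYP}_\Sigma$ (generalized solutions of the Kalman--Yakubovich--Popov inequality) is the set of all selfadjoint $H$ in $\mathcal X$ satisfying (1), (2), (5). *)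

(* Defs.v *)
From HB Require Import structures.
From mathcomp Require Import all_boot all_order all_algebra sesquilinear.
From mathcomp Require Import all_classical all_reals all_analysis.
From mathcomp.real_closed Require Import complex.
Import Order.TTheory GRing.Theory Num.Theory.
Import numFieldNormedType.Exports.

Set Implicit Arguments.
Unset Strict Implicit.
Unset Printing Implicit Defensive.

Local Open Scope classical_set_scope.
Local Open Scope ring_scope.

(** A complex Hilbert space is a complete normed space over [R[i]] whose norm
    (valued in the nonnegative reals of [R[i]]) comes from an inner product,
    linear in its first argument and conjugate-linear in the second.
    In [R[i]], [a <= b] means that [b - a] is real and nonnegative. *)
HB.mixin Record CompleteNormed_isHilbert (R : realType) V
    of CompleteNormedModule (R[i]) V := {
  inner_form : {dot V for (@Num.conj R[i])} ;
  inner_normE : forall x : V, `|x| ^+ 2 = inner_form x x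
}.

#[short(type="hilbertType")]
HB.structure Definition Hilbert (R : realType) :=
  { V of CompleteNormed_isHilbert R V & CompleteNormedModule (R[i]) V }.

Definition inner (R : realType) (V : hilbertType R) (x y : V) : R[i] :=
  inner_form x y.

Definition separable (T : topologicalType) : Prop :=
  exists2 D : set T, countable D & dense D.

(** Possibly unbounded operators: a domain together with a function of which
    only the values on the domain are meaningful. *)
Record operator (U V : Type) := Operator { dom : set U ; app :> U -> V }.

HB.instance Definition _ (U V : Type) := gen_eqMixin (operator U V).
HB.instance Definition _ (U V : Type) := gen_choiceMixin (operator U V).

Definition op_eq (U V : Type) (S T : operator U V) : Prop :=
  dom S = dom T /\ forall x, dom S x -> S x = T x.

Definition ran (U V : Type) (T : operator U V) : set V := T @` dom T.

Definition total_op (U V : Type) (f : U -> V) : operator U V :=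
  Operator setT f.

Definition comp_op (U V W : Type) (S : operator V W) (T : operator U V) :
    operator U W :=
  Operator [set x | dom T x /\ dom S (T x)] (fun x => S (T x)).

Section Operators.
Variable R : realType.

Definition add_op (U V : hilbertType R) (S T : operator U V) : operator U V :=
  Operator (dom S `&` dom T) (fun x => S x + T x).

Definition sub_op (U V : hilbertType R) (S T : operator U V) : operator U V :=
  Operator (dom S `&` dom T) (fun x => S x - T x).

Definition linear_op (U V : hilbertType R) (T : operator U V) : Prop :=
  dom T 0 /\
  forall (a : R[i]) (x y : U), dom T x -> dom T y ->
    dom T (a *: x + y) /\ T (a *: x + y) = a *: T x + T y.

Definition bounded_fun (U V : hilbertType R) (f : U -> V) : Prop :=
  exists M : R[i], forall x, `|f x| <= M * `|x|.

(** Bounded operators are everywhere defined. *)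
Definition bounded_op (U V : hilbertType R) (T : operator U V) : Prop :=
  [/\ dom T = setT, linear_op T & bounded_fun T].

(** [z] is a value at [y] of the adjoint of [T]; it is unique when [T] is
    densely defined. *)
Definition adjoint_value (U V : hilbertType R) (T : operator U V)
    (y : V) : set U :=
  [set z | forall x, dom T x -> inner (T x) y = inner x z].

Definition adjoint (U V : hilbertType R) (T : operator U V) : operator V U :=
  Operator [set y | adjoint_value T y !=set0]
           (fun y => xget 0 (adjoint_value T y)).

Definition selfadjoint (V : hilbertType R) (T : operator V V) : Prop :=
  [/\ linear_op T, dense (dom T) & op_eq T (adjoint T)].

Definition nonneg_op (V : hilbertType R) (T : operator V V) : Prop :=
  forall x, dom T x -> 0 <= inner (T x) x.

Definition is_sqrt_op (V : hilbertType R) (T S : operator V V) : Prop :=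
  [/\ selfadjoint S, nonneg_op S & op_eq (comp_op S S) T].

(** The nonnegative selfadjoint square root, which exists and is unique for
    nonnegative selfadjoint [T]; the default value only concerns other [T]. *)
Definition sqrt_op (V : hilbertType R) (T : operator V V) : operator V V :=
  xget T [set S | is_sqrt_op T S].

Definition ker_op (U V : hilbertType R) (T : operator U V) : set U :=
  [set x | dom T x /\ T x = 0].

(** [x] is the value at [y] of the Moore-Penrose pseudo-inverse of the
    selfadjoint operator [T]: [y = T_1 x + k] with [T_1] the restriction of [T]
    to the closure of its range, and [k] in the kernel of [T]. *)
Definition pinv_value (V : hilbertType R) (T : operator V V) (y : V) : set V :=
  [set x | [/\ dom T x, closure (ran T) x &
               exists2 k, ker_op T k & y = T x + k]].

Definition pinv (V : hilbertType R) (T : operator V V) : operator V V :=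
  Operator [set y | pinv_value T y !=set0]
           (fun y => xget 0 (pinv_value T y)).

(** x_{n+1} = A x_n + B u_n,  y_n = C x_n + D u_n *)
Record system (X U Y : hilbertType R) := System {
  sysA : {linear X -> X} ;
  sysB : {linear U -> X} ;
  sysC : {linear X -> Y} ;
  sysD : {linear U -> Y} ;
  sysA_bounded : bounded_fun sysA ;
  sysB_bounded : bounded_fun sysB ;
  sysC_bounded : bounded_fun sysC ;
  sysD_bounded : bounded_fun sysD
}.

Section Solutions.
Variables (X U Y : hilbertType R) (Sigma : system X U Y).

Local Notation A := (sysA Sigma).
Local Notation B := (sysB Sigma).
Local Notation C := (sysC Sigma).
Local Notation D := (sysD Sigma).
Local Notation Aop := (total_op A).
Local Notation Bop := (total_op B).
Local Notation Cop := (total_op C).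
Local Notation Dop := (total_op D).

(** I - D^* D - (H^{1/2} B)^* H^{1/2} B *)
Definition delta (H : operator X X) : operator U U :=
  let HB := comp_op (sqrt_op H) Bop in
  sub_op (sub_op (total_op id) (comp_op (adjoint Dop) Dop))
         (comp_op (adjoint HB) HB).

(** D^* C + (H^{1/2} B)^* H^{1/2} A *)
Definition cross_op (H : operator X X) : operator X U :=
  let HB := comp_op (sqrt_op H) Bop in
  add_op (comp_op (adjoint Dop) Cop)
         (comp_op (adjoint HB) (comp_op (sqrt_op H) Aop)).

Definition positive_sol (H : operator X X) : Prop :=
  forall x, dom H x -> x != 0 -> 0 < inner (H x) x.

Definition invariant_dom (H : operator X X) : Prop :=
  A @` dom (sqrt_op H) `<=` dom (sqrt_op H) /\
  range B `<=` dom (sqrt_op H).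

Definition delta_range_cond (H : operator X X) : Prop :=
  [/\ bounded_op (delta H), nonneg_op (delta H) &
      cross_op H @` dom (sqrt_op H) `<=` ran (sqrt_op (delta H))].

Definition riccati_ineq (H : operator X X) : Prop :=
  forall x, dom (sqrt_op H) x ->
    `|sqrt_op H x| ^+ 2 - `|sqrt_op H (A x)| ^+ 2 - `|C x| ^+ 2
      >= `|pinv (sqrt_op (delta H)) (cross_op H x)| ^+ 2.

Definition kyp_ineq (H : operator X X) : Prop :=
  forall (x : X) (u : U), dom (sqrt_op H) x ->
    `|sqrt_op H x| ^+ 2 + `|u| ^+ 2
      - `|sqrt_op H (A x + B u)| ^+ 2 - `|C x + D u| ^+ 2 >= 0.

Definition RI : set (operator X X) :=
  [set H | [/\ selfadjoint H, positive_sol H, invariant_dom H,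
               delta_range_cond H & riccati_ineq H]].

Definition KYP : set (operator X X) :=
  [set H | [/\ selfadjoint H, positive_sol H, invariant_dom H &
               kyp_ineq H]].

End Solutions.
End Operators.

(* Main.v *)
(** Write [S] for [H^{1/2}], [delta] for [delta_Sigma(H)], [Q] for [delta^{1/2}]
    and [K] for [D^*C + (S B)^* S A]. For [x] in the domain of [S], the
    left-hand side of the KYP inequality is [a(x) + |Q u|^2 - 2 Re <u, K x>],
    where [a(x) = |S x|^2 - |S A x|^2 - |C x|^2]. A lower bound [-a] for the
    quadratic form [|Q u|^2 - 2 Re <u, y>] holds exactly when [y = Q z] for some
    [z] in the closure of the range of [Q] with [|z|^2 <= a]: the images under
    [Q] of a minimizing sequence are Cauchy by the parallelogram law, and [z] is
    their limit. The same minimization with [Q = 1] is the Riesz representation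
    theorem, which provides the adjoints. The bound [|S B u| <= |u|] comes from
    [delta >= 0] on one side and from KYP at [x = 0] on the other, so that
    neither the closedness of [S] nor the spectral theorem is needed; only
    [delta], which satisfies [0 <= delta <= 1], must have a square root. *)

From HB Require Import structures.
From mathcomp Require Import all_boot all_order all_algebra sesquilinear.
From mathcomp Require Import all_classical all_reals all_analysis.
From mathcomp.real_closed Require Import complex.
From mathcomp Require Import ring lra.
Require Import Defs.
Import Order.TTheory GRing.Theory Num.Theory.
Import numFieldNormedType.Exports.

Set Implicit Arguments.
Unset Strict Implicit.
Unset Printing Implicit Defensive.

Local Open Scope classical_set_scope.
Local Open Scope ring_scope.
Local Open Scope complex_scope.

(** * Real part of the inner product, and the norm as a real number *)

Section RealInner.
Variables (R : realType) (V : hilbertType R).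
Implicit Types (x y z : V) (t : R).

Definition re_inner x y : R := complex.Re (inner x y).
Definition rnorm x : R := complex.Re `|x|.

Lemma innerDl x y z : inner (x + y) z = inner x z + inner y z.
Proof. by rewrite /inner linearDl. Qed.

Lemma innerZl (a : R[i]) x z : inner (a *: x) z = a * inner x z.
Proof. by rewrite /inner linearZl_LR. Qed.

Lemma innerJ x y : inner y x = (inner x y)^*.
Proof.
by rewrite /inner hermC expr0 mul1r. Qed.

Lemma re_innerC x y : re_inner x y = re_inner y x.
Proof. by rewrite /re_inner (innerJ y x); case: (inner y x). Qed.

Lemma re_innerDl x y z : re_inner (x + y) z = re_inner x z + re_inner y z.
Proof.
by rewrite /re_inner innerDl; case: (inner x z) => a b; case: (inner y z).
Qed.

Lemma re_innerDr x y z : re_inner z (x + y) = re_inner z x + re_inner z y.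
Proof. by rewrite !(re_innerC z) re_innerDl. Qed.

Lemma re_innerZl t x z : re_inner (t%:C *: x) z = t * re_inner x z.
Proof.
rewrite /re_inner innerZl; case: (inner x z) => a b /=.
by rewrite mul0r subr0.
Qed.

Lemma re_innerZr t x z : re_inner z (t%:C *: x) = t * re_inner z x.
Proof. by rewrite !(re_innerC z) re_innerZl. Qed.

Lemma re_innerNl x z : re_inner (- x) z = - re_inner x z.
Proof.
have -> : - x = (- 1)%:C *: x by rewrite rmorphN rmorph1 scaleN1r.
by rewrite re_innerZl mulN1r.
Qed.

Lemma re_innerNr x z : re_inner z (- x) = - re_inner z x.
Proof. by rewrite !(re_innerC z) re_innerNl. Qed.

Definition re_innerE :=
  (re_innerDl, re_innerDr, re_innerNl, re_innerNr, re_innerZl, re_innerZr).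

Lemma re_inner0r z : re_inner z 0 = 0.
Proof. by rewrite -(subrr z) !re_innerE subrr. Qed.

Lemma re_inner0l z : re_inner 0 z = 0.
Proof. by rewrite re_innerC re_inner0r. Qed.

Lemma innerxx x : inner x x = `|x| ^+ 2.
Proof. by rewrite inner_normE. Qed.

Lemma rnormE x : `|x| = (rnorm x)%:C.
Proof. by rewrite RRe_real // ger0_real. Qed.

Lemma rnorm_ge0 x : 0 <= rnorm x.
Proof. by rewrite -ler0c -rnormE. Qed.

Lemma re_innerxx x : re_inner x x = rnorm x ^+ 2.
Proof. by rewrite /re_inner innerxx rnormE -rmorphXn. Qed.

Lemma inner_re_innerxx x : inner x x = (re_inner x x)%:C.
Proof. by rewrite re_innerxx innerxx rnormE rmorphXn. Qed.

Lemma re_innerxx_ge0 x : 0 <= re_inner x x.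
Proof. by rewrite re_innerxx sqr_ge0. Qed.

Lemma rnorm_eq0 x : (rnorm x == 0) = (x == 0).
Proof.
by rewrite -(@normr_eq0 _ V) rnormE -(inj_eq (@complexI R)).
Qed.

Lemma re_innerxx_eq0 x : re_inner x x = 0 -> x = 0.
Proof.
by rewrite re_innerxx => /eqP; rewrite expf_eq0 /= rnorm_eq0 => /eqP.
Qed.

Lemma rnormD x y : rnorm (x + y) <= rnorm x + rnorm y.
Proof. by have := ler_normD x y; rewrite !rnormE -rmorphD lecR. Qed.

Lemma rnormN x : rnorm (- x) = rnorm x.
Proof. by rewrite /rnorm normrN. Qed.

Lemma rnormZ t x : rnorm (t%:C *: x) = `|t| * rnorm x.
Proof.
have := normrZ t%:C x; rewrite !rnormE normc_def /= expr0n /= addr0 sqrtr_sqr.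
by rewrite -rmorphM => /complexI.
Qed.

Lemma rnorm0 : rnorm 0 = 0.
Proof. by apply/eqP; rewrite rnorm_eq0. Qed.

Lemma re_inner_inj x y : (forall z, re_inner z x = re_inner z y) -> x = y.
Proof.
move=> h; apply/eqP; rewrite -subr_eq0; apply/eqP/re_innerxx_eq0.
by rewrite re_innerDr re_innerNr h subrr.
Qed.

Lemma re_inner_CS x y : `|re_inner x y| <= rnorm x * rnorm y.
Proof.
rewrite -ler_sqr ?nnegrE ?mulr_ge0 ?rnorm_ge0// real_normK ?num_real//.
rewrite exprMn -!re_innerxx.
set a := re_inner x x; set b := re_inner x y; set c := re_inner y y.
have [/re_innerxx_eq0 y0|c0] := eqVneq c 0.
  by rewrite /b /c y0 !re_inner0r expr0n mulr0.
have c_gt0 : 0 < c by rewrite lt_def c0 re_innerxx_ge0.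
(* This vector is [c] times the component of [x] orthogonal to [y] for the real form; its squared
   norm is [c (a c - b^2)]. *)
have := re_innerxx_ge0 (c%:C *: x - b%:C *: y).
rewrite !re_innerE (re_innerC y x) -/a -/b -/c => h.
have : 0 <= c * (a * c - b ^+ 2) by lra.
by rewrite pmulr_rge0// subr_ge0.
Qed.

End RealInner.

(** * Convergence, completeness and closure in terms of real norms *)

Section Limits.
Variables (R : realType) (V : hilbertType R).
Implicit Types (u : nat -> V) (l : V).

Lemma cvg_rnormP u l :
  u @ \oo --> l <-> (fun n => rnorm (u n - l)) @ \oo --> (0 : R).
Proof.
split=> [/cvgrPdist_lt h | /cvgrPdist_lt h]; apply/cvgrPdist_lt.
- move=> e e0; have := h e%:C; rewrite ltcR => /(_ e0).
  apply: filterS => n; rewrite rnormE ltcR.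
  by rewrite sub0r normrN ger0_norm ?rnorm_ge0// -rnormN opprB.
(* The radius [e] lives in [R[i]], but being positive it is real. *)
- move=> e e0; have er : e \is Num.real by apply: gtr0_real.
  rewrite -(RRe_real er) ltcR in e0.
  have := h _ e0; apply: filterS => n.
  rewrite sub0r normrN ger0_norm ?rnorm_ge0// -rnormN opprB => hn.
  by rewrite rnormE -(RRe_real er) ltcR.
Qed.

Lemma cvg_rnorm_le u l (d : nat -> R) :
  (forall n, rnorm (u n - l) <= d n) -> d @ \oo --> (0 : R) -> u @ \oo --> l.
Proof.
move=> h d0; apply/cvg_rnormP.
apply: (@squeeze_cvgr _ _ _ _ (fun=> 0) d) => //; last exact: cvg_cst.
by near=> n; rewrite rnorm_ge0 h.
Unshelve. all: by end_near.
Qed.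

(** The Cauchy criterion in the shape that both minimizing sequences and the square root iteration
    deliver. *)
Lemma hilbert_complete u (d : nat -> R) : d @ \oo --> (0 : R) ->
  (forall n m, rnorm (u n - u m) <= d n + d m) -> exists l, u @ \oo --> l.
Proof.
move=> d0 h; apply/(cvg_ex (u @ \oo))/cauchy_cvgP/cauchy_exP => e e0.
have er : e \is Num.real by apply: gtr0_real.
rewrite -(RRe_real er) ltcR in e0.
have e20 : 0 < complex.Re e / 2 by rewrite divr_gt0.
have /cvgrPdist_lt/(_ _ e20) [N _ hN] := d0.
exists (u N); exists N => // n /= Nn.
rewrite /= -ball_normE /= rnormE -(RRe_real er) ltcR.
apply: le_lt_trans (h _ _) _.
have hd k : (N <= k)%N -> d k < complex.Re e / 2.
  move=> /hN /=; rewrite sub0r normrN; apply: le_lt_trans; exact: ler_norm.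
have := hd N (leqnn N); have := hd n Nn; lra.
Qed.

Lemma cvg_re_inner u l (x : V) : u @ \oo --> l ->
  (fun n => re_inner x (u n)) @ \oo --> re_inner x l.
Proof.
move=> /cvg_rnormP ul.
have c0 : (fun n => rnorm x * rnorm (u n - l)) @ \oo --> (0 : R).
  by rewrite -(mulr0 (rnorm x)); apply: cvgM => //; exact: cvg_cst.
apply/subr_cvg0.
apply: (@squeeze_cvgr _ _ _ _ (fun n => - (rnorm x * rnorm (u n - l)))
          (fun n => rnorm x * rnorm (u n - l))) => //.
  near=> n; rewrite -ler_norml -re_innerNr -re_innerDr; exact: re_inner_CS.
by rewrite -oppr0; apply: cvgN.
Unshelve. all: by end_near.
Qed.

Lemma closure_cvg (S : set V) u l :
  u @ \oo --> l -> (forall n, S (u n)) -> closure S l.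
Proof.
move=> ul Su B /ul [N _ hN]; exists (u N); split => //; exact: (hN N (leqnn N)).
Qed.

Lemma closure_rnorm (S : set V) l (e : R) :
  closure S l -> 0 < e -> exists2 x, S x & rnorm (x - l) < e.
Proof.
move=> Sl e0.
have /Sl [x [Sx]] : nbhs l (ball l e%:C) by apply: nbhsx_ballx; rewrite ltcR.
rewrite -ball_normE /= rnormE ltcR -rnormN opprB => xl; by exists x.
Qed.

End Limits.

(** * Minimization of quadratic forms bounded below *)

Section Quadratic.
Variables (R : realType) (U V : hilbertType R).

(** The limit [z] of the images under [Q] of a minimizing sequence satisfies the Euler equation of
    the minimization. Linearity of [phi] is over the reals, as for the real part of an inner
    product. *)
Lemma quadratic_representer (Q : U -> V) (phi : U -> R) (a : R) :
  linear Q -> (forall t x y, phi (t%:C *: x + y) = t * phi x + phi y) ->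
  (forall u, - a <= re_inner (Q u) (Q u) - 2 * phi u) ->
  exists2 z, closure (range Q) z & forall v, re_inner (Q v) z = phi v.
Proof.
move=> linQ linphi bnd.
pose f u := re_inner (Q u) (Q u) - 2 * phi u.
have has_inff : has_inf (range f).
  split; first by exists (f 0), 0.
  by exists (- a) => _ [u _ <-]; exact: bnd.
set m := inf (range f).
have mf u : m <= f u by apply: ge_inf; [exact: has_inff.2|exists u].
pose d (n : nat) : R := n.+1%:R^-1.
have d_gt0 n : 0 < d n by rewrite invr_gt0.
have /choice[u fu] : forall n, exists x, f x < m + d n ^+ 2 / 2.
  move=> n.
  have e0 : 0 < d n ^+ 2 / 2 by rewrite divr_gt0 ?exprn_gt0.
  by have [_ [u _ <-] ?] := inf_adherent e0 has_inff; exists u.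
have fD t x y : f (t%:C *: x + y) = t ^+ 2 * re_inner (Q x) (Q x)
    + 2 * t * (re_inner (Q x) (Q y) - phi x) + f y.
  by rewrite /f linQ linphi !re_innerE (re_innerC (Q y)); ring.
have d0 : d @ \oo --> (0 : R) by exact: cvg_harmonic.
have [|z Qz] := @hilbert_complete _ _ (Q \o u) _ d0.
  move=> n k; rewrite -ler_sqr ?nnegrE ?addr_ge0 ?rnorm_ge0 ?ltW// -re_innerxx.
  (* At the midpoint of [u n] and [u k], [f] is the mean of its two values minus
     [|Q (u n - u k)|^2 / 4]. Since [f] is at least [m] there,
     [|Q (u n - u k)|^2 <= d n ^ 2 + d k ^ 2]. *)
  have := mf ((2^-1)%:C *: (u n - u k) + u k).
  have := fD (2^-1) (u n - u k) (u k).
  have := fD 1 (u n - u k) (u k).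
  rewrite scale1r subrK => h1 h2 h3.
  have -> : (Q \o u) n - (Q \o u) k = Q (u n - u k).
    by rewrite /= -scaleN1r addrC -linQ scaleN1r addrC.
  have := fu n; have := fu k; have := d_gt0 n; have := d_gt0 k.
  rewrite h1 in h2 *; nra.
exists z; first by apply: (closure_cvg Qz) => n; exists (u n).
move=> v; suff : (fun n => re_inner (Q v) (Q (u n))) @ \oo --> phi v.
  exact: (cvg_unique (@Rhausdorff R) (@cvg_re_inner _ _ _ _ (Q v) Qz)).
set q := re_inner (Q v) (Q v).
have h n : `|re_inner (Q v) (Q (u n)) - phi v| <= d n * (q + 1).
  (* Moving from [u n] by [d n] times [v] or [- v] cannot bring [f] below [m]; as [f (u n)] exceeds
     [m] by less than [d n ^ 2 / 2], the derivative along [v] is of order [d n]. *)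
  have := mf ((- d n)%:C *: v + u n); have := mf ((d n)%:C *: v + u n).
  rewrite !fD -/q; set g := _ - phi v; have := fu n => h0 h1 h2.
  have dn0 := d_gt0 n; have q0 : 0 <= q by exact: re_innerxx_ge0.
  rewrite -(ler_pM2l dn0) -[X in X * `|_|](gtr0_norm dn0) -normrM ler_norml.
  by apply/andP; split; nra.
have c0 : (fun n => d n * (q + 1)) @ \oo --> (0 : R).
  by rewrite -(mul0r (q + 1)); apply: cvgM => //; exact: cvg_cst.
apply/subr_cvg0.
apply: (@squeeze_cvgr _ _ _ _ (fun n => - (d n * (q + 1)))
          (fun n => d n * (q + 1))) => //.
  by near=> n; rewrite -ler_norml.
by rewrite -oppr0; apply: cvgN.
Unshelve. all: by end_near.
Qed.

(** The form equals [|Q u - z|^2 - |z|^2], and the first term can be made arbitrarily small. *)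
Lemma closure_range_bound (Q : U -> V) (z : V) (a : R) :
  closure (range Q) z ->
  (forall u, - a <= re_inner (Q u) (Q u) - 2 * re_inner (Q u) z) ->
  re_inner z z <= a.
Proof.
move=> Qz bnd; apply/ler_addgt0Pr => e e0.
have s0 : 0 < Num.sqrt e by rewrite sqrtr_gt0.
have [_ [u _ <-]] := closure_rnorm Qz s0.
rewrite -ltr_sqr ?nnegrE ?rnorm_ge0 ?(ltW s0)// sqr_sqrtr ?(ltW e0)//.
by rewrite -re_innerxx !re_innerE (re_innerC z) => h; have := bnd u; lra.
Qed.

End Quadratic.

(** * Square root of [1 - T] for a symmetric contraction [T] *)

Section SquareRoot.
Variables (R : realType) (V : hilbertType R).

(** For a complex-linear [T] this condition on real parts gives the complex one, on replacing [x] by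
    ['i *: x]. *)
Definition symmetric_fun (T : V -> V) :=
  forall x y, re_inner (T x) y = re_inner x (T y).

(* [1 - lim_n sqrt_iter T n] is a square root of [1 - T] for a contraction [T];
   [sqrt_majorant] is the same iteration for [T = 1], and bounds the operator
   norms of the iterates and of their differences. *)
Fixpoint sqrt_iter (T : V -> V) (n : nat) (x : V) : V :=
  if n is n'.+1 then
    (2^-1)%:C *: (T x + sqrt_iter T n' (sqrt_iter T n' x))
  else 0.

Fixpoint sqrt_majorant (n : nat) : R :=
  if n is n'.+1 then 2^-1 * (1 + sqrt_majorant n' ^+ 2) else 0.

Lemma sqrt_majorant_itv n : 0 <= sqrt_majorant n <= 1.
Proof.
elim: n => [|n /andP[r0 r1]] /=; first by rewrite lexx ler01.
by apply/andP; split; nra.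
Qed.

Lemma sqrt_majorantS n : sqrt_majorant n <= sqrt_majorant n.+1.
Proof. by rewrite /=; have := sqr_ge0 (sqrt_majorant n - 1); nra. Qed.

Lemma sqrt_majorant_homo :
  {homo sqrt_majorant : n m / (n <= m)%N >-> n <= m}.
Proof. exact/nondecreasing_seqP/sqrt_majorantS. Qed.

Variable T : V -> V.
Hypothesis linT : linear T.
Hypothesis symT : symmetric_fun T.
Hypothesis contrT : forall x, rnorm (T x) <= rnorm x.

Local Notation Y := (sqrt_iter T).
Local Notation r := sqrt_majorant.

Lemma sqrt_iter_linear n : linear (Y n).
Proof.
elim: n => [|n IH] a x y /=; first by rewrite scaler0 addr0.
rewrite linT !IH !scalerDr !scalerA (mulrC a) addrACA.
by rewrite -!scalerA.
Qed.

Lemma sqrt_iter_sym n : symmetric_fun (Y n).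
Proof.
elim: n => [|n IH] x y /=; first by rewrite re_inner0l re_inner0r.
by rewrite !re_innerE symT !IH.
Qed.

Lemma sqrt_iterB n x y : Y n (x - y) = Y n x - Y n y.
Proof. by rewrite addrC -scaleN1r sqrt_iter_linear scaleN1r addrC. Qed.

Lemma sqrt_iter_bound n x : rnorm (Y n x) <= r n * rnorm x.
Proof.
elim: n x => [|n IH] x /=; first by rewrite rnorm0 mul0r.
rewrite rnormZ gtr0_norm ?invr_gt0// -mulrA ler_pM2l ?invr_gt0//.
apply: le_trans (rnormD _ _) _; rewrite mulrDl mul1r expr2 -mulrA.
apply: lerD (contrT x) _; apply: le_trans (IH _) _.
by have /andP[r0 _] := sqrt_majorant_itv n; exact: ler_wpM2l (IH x).
Qed.

Lemma sqrt_iter_step n x :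
  rnorm (Y n.+1 x - Y n x) <= (r n.+1 - r n) * rnorm x.
Proof.
elim: n x => [|n IH] x.
  rewrite /= subr0 rnormZ gtr0_norm ?invr_gt0// addr0.
  rewrite expr0n /= addr0 mulr1 subr0 ler_pM2l ?invr_gt0//; exact: contrT.
(* The difference of the squares of [Y n.+1] and [Y n] is split in a way that does not require the
   iterates to commute. The majorant obeys the same recursion with equality. *)
have -> : Y n.+2 x - Y n.+1 x = (2^-1)%:C *:
    (Y n.+1 (Y n.+1 x - Y n x) + (Y n.+1 (Y n x) - Y n (Y n x))).
  rewrite sqrt_iterB addrA subrK.
  rewrite [in LHS]/sqrt_iter -/sqrt_iter -scalerBr opprD addrACA subrr add0r.
  by [].
rewrite rnormZ gtr0_norm ?invr_gt0//.
have /andP[r0 _] := sqrt_majorant_itv n.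
have /andP[s0 _] := sqrt_majorant_itv n.+1.
have rs := sqrt_majorantS n.
have h1 := rnormD (Y n.+1 (Y n.+1 x - Y n x)) (Y n.+1 (Y n x) - Y n (Y n x)).
have h2 : rnorm (Y n.+1 (Y n.+1 x - Y n x)) <=
    r n.+1 * ((r n.+1 - r n) * rnorm x).
  by apply: le_trans (sqrt_iter_bound _ _) _; exact: ler_wpM2l.
have h3 : rnorm (Y n.+1 (Y n x) - Y n (Y n x)) <=
    (r n.+1 - r n) * (r n * rnorm x).
  apply: le_trans (IH _) _; apply: ler_wpM2l; first by rewrite subr_ge0.
  exact: sqrt_iter_bound.
have -> : r n.+2 - r n.+1 = 2^-1 * (r n.+1 ^+ 2 - r n ^+ 2)
  by rewrite /=; field.
move: h1 h2 h3; set e1 := rnorm _; set e2 := rnorm _; set e3 := rnorm _.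
set s := r n.+1; set t := r n; set w := rnorm x => h1 h2 h3.
rewrite -mulrA ler_pM2l ?invr_gt0//; lra.
Qed.

Lemma sqrt_iter_dist n m x : (n <= m)%N ->
  rnorm (Y m x - Y n x) <= (r m - r n) * rnorm x.
Proof.
elim: m => [|m IH].
  by rewrite leqn0 => /eqP->; rewrite !subrr rnorm0 mul0r.
rewrite leq_eqVlt => /predU1P[->|]; first by rewrite !subrr rnorm0 mul0r.
rewrite ltnS => /IH h; have := sqrt_iter_step m x.
have := rnormD (Y m.+1 x - Y m x) (Y m x - Y n x).
rewrite addrA subrK; lra.
Qed.

Lemma sqrt_iter_cvg x : exists l : V, (fun n => Y n x) @ \oo --> l.
Proof.
have cvgr : cvgn r.
  apply: nondecreasing_is_cvgn => //; first exact: sqrt_majorant_homo.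
  by exists 1 => _ [n _ <-]; have /andP[] := sqrt_majorant_itv n.
set L := limn r.
have rL n : r n <= L.
  by apply: nondecreasing_cvgn_le => //; exact: sqrt_majorant_homo.
apply: (@hilbert_complete _ _ _ (fun n => (L - r n) * rnorm x)).
  rewrite -(mul0r (rnorm x)); apply: cvgM; last exact: cvg_cst.
  by rewrite -(subrr L); apply: cvgB => //; exact: cvg_cst.
move=> n m; have x0 := rnorm_ge0 x.
wlog nm : n m / (n <= m)%N.
  move=> h; case/orP: (leq_total n m) => nm; first exact: h.
  by rewrite -rnormN opprB [leRHS]addrC; exact: h.
rewrite -rnormN opprB; have := sqrt_iter_dist x nm.
have := rL n; have := rL m; nra.
Qed.

(** The limit [Z] of the iteration satisfies [2 Z = T + Z^2], that is [(1 - Z)^2 = 1 - T]; and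
    [1 - Z] is nonnegative because [Z] is a limit of contractions. *)
Lemma contraction_sqrt : exists Q : V -> V,
  [/\ linear Q, symmetric_fun Q, forall x, 0 <= re_inner (Q x) x &
      forall x, Q (Q x) = x - T x].
Proof.
have /choice[Z cvgZ'] := sqrt_iter_cvg.
have cle n x : rnorm (Y n x) <= rnorm x.
  apply: le_trans (sqrt_iter_bound _ _) _.
  by have /andP[_ h] := sqrt_majorant_itv n; exact: ler_piMl (rnorm_ge0 _) h.
have ZE x (l : V) : (fun n => Y n x) @ \oo --> l -> Z x = l.
  by move=> h; exact: (norm_cvg_unique (cvgZ' x) h).
have linZ : linear Z.
  move=> a x y; apply: ZE.
  under eq_fun do rewrite sqrt_iter_linear.
  by apply: cvgD => //; apply: cvgZ => //; exact: cvg_cst.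
have symZ : symmetric_fun Z.
  move=> x y.
  have h1 := @cvg_re_inner _ _ _ _ x (cvgZ' y).
  have h2 := @cvg_re_inner _ _ _ _ y (cvgZ' x).
  have eqY : (fun n => re_inner y (Y n x)) = (fun n => re_inner x (Y n y)).
    by apply/funext => n; rewrite re_innerC sqrt_iter_sym.
  rewrite re_innerC; rewrite eqY in h2.
  exact: (cvg_unique (@Rhausdorff R) h2 h1).
have Z1 x : re_inner (Z x) x <= re_inner x x.
  rewrite re_innerC; apply: (cvgr_to_le (@cvg_re_inner _ _ _ _ x (cvgZ' x))).
  near=> n; apply: le_trans (ler_norm _) _; apply: le_trans (re_inner_CS _ _) _.
  by rewrite re_innerxx expr2 ler_wpM2l ?rnorm_ge0.
have ZZ x : Z x = (2^-1)%:C *: (T x + Z (Z x)).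
  apply: ZE; rewrite -cvg_shiftS /=.
  apply: cvgZ; first exact: cvg_cst.
  apply: cvgD; first exact: cvg_cst.
  apply: (@cvg_rnorm_le _ _ _ _ (fun n =>
     rnorm (Y n x - Z x) + rnorm (Y n (Z x) - Z (Z x)))).
    move=> n.
    (* Since every [Y n] is a contraction, pointwise convergence passes to the composite. *)
    have -> : Y n (Y n x) - Z (Z x) =
        Y n (Y n x - Z x) + (Y n (Z x) - Z (Z x)).
      by rewrite sqrt_iterB addrA subrK.
    apply: le_trans (rnormD _ _) _; exact: lerD (cle _ _) (lexx _).
  by rewrite -(addr0 0); apply: cvgD; apply/cvg_rnormP; exact: cvgZ'.
have ZB x y : Z (x - y) = Z x - Z y.
  by rewrite addrC -scaleN1r linZ scaleN1r addrC.
exists (fun x => x - Z x); split.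
- by move=> a x y; rewrite linZ scalerBr opprD addrACA.
- by move=> x y; rewrite !re_innerE symZ.
- by move=> x; rewrite !re_innerE subr_ge0.
- move=> x; rewrite ZB opprB.
  have := ZZ x; set z := Z x; set zz := Z z => h.
  have -> : T x = z + z - zz.
    rewrite h -scalerDl -rmorphD.
    have -> : 2^-1 + 2^-1 = 1 :> R by lra.
    by rewrite scale1r addrK.
  by rewrite !opprD opprK !addrA addrAC.
Unshelve. all: by end_near.
Qed.

End SquareRoot.

(** * From real parts back to the complex inner product *)

Section ComplexInner.
Variables (R : realType) (U V : hilbertType R).

Lemma innerDr (x y z : V) : inner z (x + y) = inner z x + inner z y.
Proof.
rewrite (innerJ (x + y)) innerDl (innerJ x) (innerJ y).
by case: (inner x z) => a b; case: (inner y z) => c d; congr Complex; lra.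
Qed.

Lemma innerZr (a : R[i]) (x z : V) : inner z (a *: x) = a^* * inner z x.
Proof.
rewrite (innerJ (a *: x)) innerZl (innerJ x).
by case: a => c d; case: (inner x z) => e f; congr Complex; lra.
Qed.

Lemma inner_inj (x y : V) : (forall z, inner z x = inner z y) -> x = y.
Proof. by move=> h; apply: re_inner_inj => z; rewrite /re_inner h. Qed.

(** The hypothesis at ['i *: x] yields the equality of the imaginary parts. *)
Lemma inner_adjoint_of_re (T : U -> V) (y : V) (z : U) : linear T ->
  (forall x, re_inner (T x) y = re_inner x z) ->
  forall x, inner (T x) y = inner x z.
Proof.
move=> linT h x; have h0 := h x; have := h ('i *: x).
have -> : T ('i *: x) = 'i *: T x.
  have T0 : T 0 = 0.
    by have := linT (-1) 0 0; rewrite scaler0 addr0 scaleN1r addNr.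
  by rewrite -[in LHS](addr0 ('i *: x)) linT T0 addr0.
move: h0; rewrite /re_inner !innerZl.
case: (inner (T x) y) => a b; case: (inner x z) => c d /=.
by move=> -> bd; congr Complex; lra.
Qed.

End ComplexInner.

(** * Adjoints of bounded operators *)

Section Adjoint.
Variables (R : realType) (U V : hilbertType R) (T : operator U V).

Lemma adjointP y : dom (adjoint T) y -> adjoint_value T y (adjoint T y).
Proof. by move=> ?; exact: xgetPex. Qed.

Lemma adjointE y z : dom T = setT -> adjoint_value T y z -> adjoint T y = z.
Proof.
move=> domT Tyz; have /adjointP Ty : dom (adjoint T) y by exists z.
by apply: inner_inj => x; rewrite -Ty ?domT// -Tyz ?domT.
Qed.

Lemma adjoint_dom (c : R) : linear T ->
  (forall x, re_inner (T x) (T x) <= c * re_inner x x) ->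
  dom (adjoint T) = setT.
Proof.
move=> linT bnd; apply/seteqP; split=> // y _.
(* A positive constant above [c]: expanding [|T u - s y|^2 >= 0] and dividing by [s] gives the lower
   bound [- s |y|^2] for [|u|^2 - 2 Re <T u, y>]. *)
pose s := `|c| + 1.
have s0 : 0 < s by rewrite ltr_wpDl.
have linphi t x x' :
    re_inner (T (t%:C *: x + x')) y = t * re_inner (T x) y + re_inner (T x') y.
  by rewrite linT !re_innerE.
have [u|z _ hz] := @quadratic_representer _ U U id _ (s * re_inner y y)
    (fun _ _ _ => erefl) linphi.
  have := re_innerxx_ge0 (T u - s%:C *: y).
  rewrite !re_innerE (re_innerC y) => h1.
  have h2 : re_inner (T u) (T u) <= s * re_inner u u.
    apply: le_trans (bnd u) _; apply: ler_wpM2r; first exact: re_innerxx_ge0.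
    by rewrite /s; have := ler_norm c; lra.
  rewrite -subr_ge0 -(pmulr_rge0 _ s0); lra.
exists z => x _; exact: inner_adjoint_of_re.
Qed.

End Adjoint.

Lemma bounded_fun_re (R : realType) (U V : hilbertType R) (f : U -> V) :
  bounded_fun f ->
  exists c : R, forall x, re_inner (f x) (f x) <= c * re_inner x x.
Proof.
move=> [M hM]; exists (complex.Re M ^+ 2) => x.
rewrite !re_innerxx -exprMn; apply: lerXn2r; rewrite ?nnegrE ?rnorm_ge0//.
  apply: le_trans (rnorm_ge0 (f x)) _.
  have := hM x; rewrite !rnormE lecE => /andP[_].
  by case: M {hM} => a b /=; rewrite mulr0 subr0.
have := hM x; rewrite !rnormE lecE => /andP[_].
by case: M {hM} => a b /=; rewrite mulr0 subr0.
Qed.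

(** * Symmetric operators: square roots and pseudo-inverses *)

Section Symmetric.
Variables (R : realType) (V : hilbertType R).

Lemma normr_sqr_re (x : V) : `|x| ^+ 2 = (re_inner x x)%:C.
Proof. by rewrite -innerxx inner_re_innerxx. Qed.

Lemma inner_symmetricE (T : V -> V) x : linear T -> symmetric_fun T ->
  inner (T x) x = (re_inner (T x) x)%:C.
Proof.
move=> linT symT; have := inner_adjoint_of_re linT (fun y => symT y x) x.
rewrite (innerJ (T x) x) /re_inner; case: (inner (T x) x) => a b [] /= hb.
by congr Complex; lra.
Qed.

Section UnitInterval.
Variable T : V -> V.
Hypotheses (linT : linear T) (symT : symmetric_fun T).
Hypothesis T01 : forall x, 0 <= re_inner (T x) x <= re_inner x x.

(* [T - T^2 = T (1 - T) T + (1 - T) T (1 - T)]. *)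
Lemma unit_interval_sqr_le x : re_inner (T x) (T x) <= re_inner (T x) x.
Proof.
have TB y z : T (y - z) = T y - T z.
  by rewrite addrC -scaleN1r linT scaleN1r addrC.
have /andP[_ h1] := T01 (T x).
have /andP[h2 _] := T01 (x - T x).
move: h2; rewrite TB !re_innerE (symT (T x) x); lra.
Qed.

Lemma unit_interval_contraction x : rnorm (x - T x) <= rnorm x.
Proof.
rewrite -ler_sqr ?nnegrE ?rnorm_ge0// -!re_innerxx !re_innerE (re_innerC x).
have := unit_interval_sqr_le x; have /andP[] := T01 x; lra.
Qed.

End UnitInterval.

(** The root of [1 - (1 - T)] shows that a square root exists, so the chosen [sqrt_op T] is one. Its
    properties are then read off from [is_sqrt_op], without identifying it with the constructed
    root. *)
Lemma sqrt_op_unit_interval (T : operator V V) :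
  dom T = setT -> linear T -> symmetric_fun T ->
  (forall x, 0 <= re_inner (T x) x <= re_inner x x) ->
  [/\ dom (sqrt_op T) = setT, linear (sqrt_op T), symmetric_fun (sqrt_op T) &
      forall x, sqrt_op T (sqrt_op T x) = T x].
Proof.
move=> domT linT symT T01.
have [|||Q [linQ symQ Q0 QQ]] := @contraction_sqrt _ V (fun x => x - T x).
- by move=> a x y; rewrite linT scalerBr opprD addrACA.
- by move=> x y; rewrite !re_innerE symT.
- exact: unit_interval_contraction.
have isQ : is_sqrt_op T (total_op Q).
  split.
  - split; first by split=> // a x y _ _; split=> //; exact: linQ.
      by move=> O [x Ox] Oo; exists x.
    have adjQ y : adjoint_value (total_op Q) y (Q y).
      by move=> x _; exact: (inner_adjoint_of_re linQ (fun x => symQ x y)).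
    split; first by apply/seteqP; split=> // y _; exists (Q y); exact: adjQ.
    by move=> y _; rewrite (adjointE _ (adjQ y)).
  - by move=> x _; rewrite inner_symmetricE// ler0c.
  - split; first by rewrite domT; apply/seteqP.
    by move=> x _ /=; rewrite QQ opprB addrC subrK.
have [[linS _ selfS] _ [domSS SS]] : is_sqrt_op T (sqrt_op T).
  by rewrite /sqrt_op; apply: (xgetPex T); exists (total_op Q).
have domS : dom (sqrt_op T) = setT.
  apply/seteqP; split=> // x _.
  have : dom (comp_op (sqrt_op T) (sqrt_op T)) x by rewrite domSS domT.
  by case.
split=> //.
- by move=> a x y; have [_ /(_ a x y)[]] := linS; rewrite ?domS.
- move=> x y; have [domadj adjS] := selfS.
  rewrite [in RHS]adjS ?domS// /re_inner.
  have /adjointP -> // : dom (adjoint (sqrt_op T)) y by rewrite -domadj domS.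
  by rewrite domS.
- by move=> x; rewrite -SS ?domSS ?domT.
Qed.

(** Minimizing [|Q u - w|^2] gives [z] in the closure of the range with [Q z = Q w], so the
    pseudo-inverse is defined at [Q w]. *)
Lemma pinv_range (Q : operator V V) w :
  dom Q = setT -> linear Q -> symmetric_fun Q ->
  closure (range Q) (pinv Q (Q w)) /\ Q (pinv Q (Q w)) = Q w.
Proof.
move=> domQ linQ symQ.
have QB y z : Q (y - z) = Q y - Q z.
  by rewrite addrC -scaleN1r linQ scaleN1r addrC.
have [t x y|u|z clz hz] := @quadratic_representer _ V V Q
    (fun u => re_inner u (Q w)) (re_inner w w) linQ.
- by rewrite !re_innerE.
- rewrite -(symQ u w); have := re_innerxx_ge0 (Q u - w).
  rewrite !re_innerE (re_innerC w); lra.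
have Qz : Q z = Q w by apply: re_inner_inj => v; rewrite -hz symQ.
have : pinv_value Q (Q w) (pinv Q (Q w)).
  apply: (xgetPex 0); exists z; split; rewrite ?domQ// /ran ?domQ//.
  exists 0; last by rewrite Qz addr0.
  split; rewrite ?domQ//.
  by rewrite -[X in Q X](subrr 0) QB subrr.
set p := pinv Q (Q w) => -[_]; rewrite /ran domQ => clp [k [_ Qk] Qpk].
split=> //; suff k0 : k = 0 by rewrite Qpk k0 addr0.
(* The kernel component [k] also lies in the range of the symmetric [Q], hence is orthogonal to
   itself. *)
apply: re_innerxx_eq0; have kE : k = Q (w - p).
  by rewrite QB Qpk addrAC subrr add0r.
by rewrite {1}kE symQ Qk re_inner0r.
Qed.

End Symmetric.

(** * The operator [delta], the cross term, and the equivalence of the two inequalities *)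

Section Solutions.
Variables (R : realType) (X U Y : hilbertType R) (Sigma : system X U Y).
Variable H : operator X X.
Hypotheses (selfH : selfadjoint H) (invH : invariant_dom Sigma H).

Local Notation A := (sysA Sigma).
Local Notation B := (sysB Sigma).
Local Notation C := (sysC Sigma).
Local Notation D := (sysD Sigma).
Local Notation S := (sqrt_op H).
Local Notation delta := (delta Sigma H).
Local Notation Q := (sqrt_op delta).
Local Notation cross := (cross_op Sigma H).

(* If [H] had no square root, [sqrt_op H] would be [H], still a linear one. *)
Lemma sqrt_op_linear : linear_op S.
Proof.
rewrite /sqrt_op; case: xgetP => [T -> [[]]//|_]; by case: selfH.
Qed.

Lemma sqrt_op_domA x : dom S x -> dom S (A x).
Proof. by case: invH => h _ Sx; apply: h; exists x. Qed.

Lemma sqrt_op_domB u : dom S (B u).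
Proof. by case: invH => _; apply; exists u. Qed.

Lemma sqrt_op0 : S 0 = 0.
Proof.
have [d0 /(_ (-1) 0 0 d0 d0)[_]] := sqrt_op_linear.
by rewrite scaler0 addr0 scaleN1r addNr.
Qed.

Lemma sqrt_opD x y : dom S x -> dom S y -> S (x + y) = S x + S y.
Proof.
move=> dx dy; have [_ /(_ 1 x y dx dy)[_]] := sqrt_op_linear.
by rewrite !scale1r.
Qed.

Lemma sqrt_op_B_linear : linear (fun u => S (B u)).
Proof.
move=> a u v; have [_ h] := sqrt_op_linear; rewrite linearP.
by have [_ ->] := h a _ _ (sqrt_op_domB u) (sqrt_op_domB v).
Qed.

Lemma inner_delta u v : dom delta u ->
  inner v (delta u) = inner v u - inner (D v) (D u) - inner (S (B v)) (S (B u)).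
Proof.
have inNr (W : hilbertType R) (x y : W) : inner x (- y) = - inner x y.
  by rewrite -scaleN1r innerZr rmorphN rmorph1 mulN1r.
move=> [[_ [_ /adjointP dD]] [_ /adjointP dB]].
rewrite /= !innerDr !inNr -dD// -dB//=; split=> //; exact: sqrt_op_domB.
Qed.

Lemma re_inner_delta u v : dom delta u ->
  re_inner v (delta u) =
  re_inner v u - re_inner (D v) (D u) - re_inner (S (B v)) (S (B u)).
Proof.
move=> du; rewrite /re_inner inner_delta//.
case: (inner v u) => ? ?; case: (inner (D v) _) => ? ?.
by case: (inner (S _) _) => ? ?.
Qed.

Lemma delta_range_cond_contr : delta_range_cond Sigma H ->
  forall u, re_inner (D u) (D u) + re_inner (S (B u)) (S (B u)) <= re_inner u u.
Proof.
move=> [[domd _ _] nnd _] u; have du : dom delta u by rewrite domd.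
have := nnd u du; rewrite lecE => /andP[_].
rewrite -/(re_inner _ _) re_innerC re_inner_delta//= => h; lra.
Qed.

Lemma kyp_ineq_contr : kyp_ineq Sigma H ->
  forall u, re_inner (D u) (D u) + re_inner (S (B u)) (S (B u)) <= re_inner u u.
Proof.
move=> kyp u; have [d0 _] := sqrt_op_linear; have := kyp 0 u d0.
rewrite !linear0 !add0r sqrt_op0 normr0 expr0n /= add0r.
rewrite !normr_sqr_re -!rmorphB ler0c; lra.
Qed.

(** Each of the two conditions implies this bound, so the properties of [delta] derived from it
    serve both implications. *)
Hypothesis contr : forall u,
  re_inner (D u) (D u) + re_inner (S (B u)) (S (B u)) <= re_inner u u.

Let domSB : dom (comp_op S (total_op B)) = setT.
Proof. by apply/seteqP; split=> // u _; split=> //; exact: sqrt_op_domB. Qed.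

Let dom_adjD : dom (adjoint (total_op D)) = setT.
Proof.
have [c hc] := bounded_fun_re (sysD_bounded Sigma).
by apply: (@adjoint_dom _ _ _ (total_op D) c) => //; exact: linearP.
Qed.

Let dom_adjSB : dom (adjoint (comp_op S (total_op B))) = setT.
Proof.
apply: (@adjoint_dom _ _ _ _ 1); first exact: sqrt_op_B_linear.
move=> u /=; have := contr u; have := re_innerxx_ge0 (D u); lra.
Qed.

Lemma delta_dom : dom delta = setT.
Proof.
apply/seteqP; split=> // u _.
have dD : dom (adjoint (total_op D)) (D u) by rewrite dom_adjD.
have dB : dom (adjoint (comp_op S (total_op B))) (S (B u)).
  by rewrite dom_adjSB.
by split; split=> //; split=> //; exact: sqrt_op_domB.
Qed.

Let in_delta_dom u : dom delta u. Proof. by rewrite delta_dom. Qed.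

Lemma re_inner_cross x v : dom S x ->
  re_inner v (cross x) = re_inner (D v) (C x) + re_inner (S (B v)) (S (A x)).
Proof.
move=> dx; rewrite /= re_innerDr /re_inner.
have /adjointP dD : dom (adjoint (total_op D)) (C x) by rewrite dom_adjD.
have /adjointP dB : dom (adjoint (comp_op S (total_op B))) (S (A x)).
  by rewrite dom_adjSB.
by rewrite -dD// -dB// domSB.
Qed.

Lemma delta_linear : linear delta.
Proof.
move=> a u v; apply: inner_inj => w.
rewrite inner_delta// (innerDr (a *: delta u)) (innerZr a (delta u)).
rewrite !inner_delta//.
have [_ SD] := sqrt_op_linear; rewrite !linearP.
have [_ ->] := SD a _ _ (sqrt_op_domB u) (sqrt_op_domB v).
by rewrite !innerDr !innerZr; ring.
Qed.

Lemma delta_symmetric : symmetric_fun delta.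
Proof.
move=> u v; rewrite re_innerC !re_inner_delta// (re_innerC u).
by rewrite (re_innerC (D u)) (re_innerC (S (B u))).
Qed.

Lemma delta_unit_interval u : 0 <= re_inner (delta u) u <= re_inner u u.
Proof.
rewrite re_innerC re_inner_delta//; have := contr u.
have := re_innerxx_ge0 (D u); have := re_innerxx_ge0 (S (B u)).
by move=> *; apply/andP; split; lra.
Qed.

(** From [0 <= delta <= 1] follows [|delta u|^2 <= <delta u, u> <= |u|^2]. *)
Lemma delta_bounded : bounded_op delta.
Proof.
split; first exact: delta_dom.
  by split=> // a u v _ _; split=> //; exact: delta_linear.
exists 1 => u; rewrite mul1r !rnormE lecR.
rewrite -ler_sqr ?nnegrE ?rnorm_ge0// -!re_innerxx.
have := unit_interval_sqr_le delta_linear delta_symmetric delta_unit_interval u.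
have /andP[_] := delta_unit_interval u; lra.
Qed.

Lemma delta_nonneg : nonneg_op delta.
Proof.
move=> u _; rewrite inner_symmetricE ?ler0c.
- by have /andP[] := delta_unit_interval u.
- exact: delta_linear.
- exact: delta_symmetric.
Qed.

Lemma sqrt_deltaP : [/\ dom Q = setT, linear Q, symmetric_fun Q &
  forall u, Q (Q u) = delta u].
Proof.
apply: sqrt_op_unit_interval; [exact: delta_dom|exact: delta_linear|..].
  exact: delta_symmetric.
exact: delta_unit_interval.
Qed.

Lemma kypE x u : dom S x ->
  `|S x| ^+ 2 + `|u| ^+ 2 - `|S (A x + B u)| ^+ 2 - `|C x + D u| ^+ 2 =
  (re_inner (S x) (S x) - re_inner (S (A x)) (S (A x)) - re_inner (C x) (C x)
   + re_inner (Q u) (Q u) - 2 * re_inner u (cross x))%:C.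
Proof.
move=> dx; have [_ _ symQ QQ] := sqrt_deltaP.
rewrite sqrt_opD; [|exact: sqrt_op_domA|exact: sqrt_op_domB].
rewrite !normr_sqr_re -rmorphD -!rmorphB; congr (_%:C).
rewrite symQ QQ re_inner_delta// re_inner_cross// !re_innerE.
rewrite (re_innerC (S (A x)) (S (B u))) (re_innerC (C x) (D u)); ring.
Qed.

Lemma riccati_kyp : delta_range_cond Sigma H -> riccati_ineq Sigma H ->
  kyp_ineq Sigma H.
Proof.
move=> [_ _ rng] ric x u dx; rewrite kypE// ler0c.
have [domQ linQ symQ QQ] := sqrt_deltaP.
have [|w _ Qw] := rng (cross x); first by exists x.
have [_ Qp] := pinv_range w domQ linQ symQ.
have := ric x dx; rewrite !normr_sqr_re -!rmorphB lecR -Qw.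
rewrite -[in re_inner u _]Qp -(symQ u); set p := pinv Q _.
(* Completing the square: [|Q u|^2 - 2 Re <Q u, p> >= - |p|^2], and the Riccati inequality bounds
   [|p|^2]. *)
have := re_innerxx_ge0 (Q u - p).
by rewrite !re_innerE (re_innerC p); lra.
Qed.

Lemma kyp_riccati : kyp_ineq Sigma H ->
  delta_range_cond Sigma H /\ riccati_ineq Sigma H.
Proof.
move=> kyp; have [domQ linQ symQ QQ] := sqrt_deltaP.
pose a x := re_inner (S x) (S x) - re_inner (S (A x)) (S (A x))
  - re_inner (C x) (C x).
have bnd x u : dom S x ->
    - a x <= re_inner (Q u) (Q u) - 2 * re_inner u (cross x).
  by move=> dx; have := kyp x u dx; rewrite kypE// ler0c /a; lra.
have rng x : dom S x -> exists w, Q w = cross x.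
  (* For fixed [x], KYP bounds the form in [u] below by [- a x], so its linear part is represented
     through [Q]. *)
  move=> dx; have [t y z|z _ hz] := @quadratic_representer _ U U Q
    (fun u => re_inner u (cross x)) (a x) linQ _ (fun u => bnd x u dx).
    by rewrite re_innerDl re_innerZl.
  by exists z; apply: re_inner_inj => v; rewrite -hz symQ.
split.
  split; [exact: delta_bounded|exact: delta_nonneg|].
  by move=> _ [x dx <-]; have [w Qw] := rng x dx; exists w; rewrite ?domQ.
move=> x dx; rewrite !normr_sqr_re -!rmorphB lecR -/(a x).
have [w Qw] := rng x dx.
have [clp Qp] := pinv_range w domQ linQ symQ.
(* By symmetry of [Q], the linear term [Re <u, cross x>] is [Re <Q u, p>] with [p] the
   pseudo-inverse value, so the same lower bound controls [|p|^2]. *)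
rewrite -Qw; apply: closure_range_bound clp _ => u.
by rewrite (symQ u (pinv _ _)) Qp Qw; exact: bnd.
Qed.

End Solutions.

Theorem theorem3p1 (R : realType) (X U Y : hilbertType R)
    (sepX : separable X) (sepU : separable U) (sepY : separable Y)
    (Sigma : system X U Y) :
  RI Sigma = KYP Sigma.
Proof.
apply/seteqP; split=> H [selfH posH invH].
  move=> del ric; split=> //.
  exact: (riccati_kyp selfH invH (delta_range_cond_contr invH del)).
move=> kyp.
by have [] := kyp_riccati selfH invH (kyp_ineq_contr selfH kyp) kyp; split.
Qed.
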